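(* Let $M$ be a smooth manifold of dimension $n$, let $a=\gamma_{ij}(x)y^iy^j$ be (the quadratic form of) a Riemannian metric on $M$, and let $b=b_i(x)y^i$ be (the linear function on tangent vectors given by) a 1-form on $M$ such that $\|b\|^2=\gamma^{ij}b_ib_j=1$ at every point. Let $T=a\cdot b$ and $F=\sqrt[3]{T}$. Then the space $(M,F)$ is of Berwald type if and only if $b$ is parallel with respect to the Levi-Civita connection $\nabla$ of $\gamma$, that is, $\nabla_ib_j=0$ for all $i,j=1,\dots,n$.
   Context: $(x^i,y^i)$ are the induced local coordinates on $TM$ and $(\gamma^{ij})$ is the inverse matrix of $(\gamma_{ij})$. Finsler spaces are understood in the wider sense: $F$ is considered on the open conic subset of $TM\setminus0$ where $T\neq0$ (i.e. $b\neq 0$) and the Hessian $\left[\frac{\partial^2T}{\partial y^i\partial y^j}\right]$ is invertible (i.e. $4b^2-a\neq0$); there the metric tensor $g_{ij}=\frac12\frac{\partial^2F^2}{\partial y^i\partial y^j}$ is nondegenerate (not necessarily positive definite), with inverse $g^{ij}$. The canonical spray coefficients $G^i$ of $F$ are given by $2G^i=\frac12 g^{ih}\left(\frac{\partial^2F^2}{\partial y^h\partial x^k}y^k-\frac{\partial F^2}{\partial x^h}\right)$. The space $(M,F)$ is of Berwald type if the Berwald connection coefficients $G^i_{\ jk}=\frac{\partial^2G^i}{\partial y^j\partial y^k}$ are functions of $x$ alone; equivalently, if the $G^i$ are homogeneous polynomials of degree 2 in $y$. *)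

(* Defs.v *)
From HB Require Import structures.
From mathcomp Require Import all_boot all_order all_algebra.
From mathcomp Require Import all_classical all_reals all_analysis.

Set Implicit Arguments.
Unset Strict Implicit.
Unset Printing Implicit Defensive.

Import Order.TTheory GRing.Theory Num.Theory.
Import numFieldNormedType.Exports.

Local Open Scope classical_set_scope.
Local Open Scope ring_scope.

Section EuclideanCalculus.
Context {R : realType} {n : nat}.
Implicit Types (f : 'rV[R]_n -> R) (x : 'rV[R]_n) (U : set 'rV[R]_n).

Definition partial (i : 'I_n) f x : R := 'D_(delta_mx 0 i) f x.

Definition iter_partial (s : seq 'I_n) f : 'rV[R]_n -> R :=
  foldr partial f s.

(* For open [U] this is the class C^oo(U): differentiability of every iterated
   partial derivative makes all of them continuous. *)
Definition smooth_on U f : Prop :=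
  forall (s : seq 'I_n) x, U x -> differentiable (iter_partial s f) x.

End EuclideanCalculus.

(* The map and its inverse are total functions; only their restrictions to
   [chart_dom] and [chart_cod] are meaningful. *)
Record chart (R : realType) (n : nat) (M : topologicalType) := Chart {
  chart_dom : set M;
  chart_cod : set 'rV[R]_n;
  chart_map : M -> 'rV[R]_n;
  chart_inv : 'rV[R]_n -> M;
  chart_dom_open : open chart_dom;
  chart_cod_open : open chart_cod;
  chart_map_cod : forall p, chart_dom p -> chart_cod (chart_map p);
  chart_inv_dom : forall x, chart_cod x -> chart_dom (chart_inv x);
  chart_mapK : forall p, chart_dom p -> chart_inv (chart_map p) = p;
  chart_invK : forall x, chart_cod x -> chart_map (chart_inv x) = x;
  chart_map_cont : forall p, chart_dom p -> {for p, continuous chart_map};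
  chart_inv_cont : forall x, chart_cod x -> {for x, continuous chart_inv}
}.

Section Transition.
Context {R : realType} {n : nat} {M : topologicalType}.
Implicit Types c : chart R n M.

Definition transition c1 c2 (x : 'rV[R]_n) : 'rV[R]_n :=
  chart_map c2 (chart_inv c1 x).

Definition overlap c1 c2 : set 'rV[R]_n :=
  [set x | chart_cod c1 x /\ chart_dom c2 (chart_inv c1 x)].

(* Entry (i, j) is the derivative of the j-th new coordinate along the i-th old
   one, so that a tangent row vector [y] is sent to [y *m jacobian_mx]. *)
Definition jacobian_mx c1 c2 (x : 'rV[R]_n) : 'M[R]_n :=
  \matrix_(i, j) partial i (fun z => transition c1 c2 z 0 j) x.

End Transition.

(* The atlas need not be maximal. *)
Record smooth_manifold (R : realType) (n : nat) := SmoothManifold {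
  carrier :> topologicalType;
  carrier_hausdorff : hausdorff_space carrier;
  carrier_second_countable : @second_countable carrier;
  atlas : set (chart R n carrier);
  atlas_cover : forall p : carrier, exists2 c, atlas c & chart_dom c p;
  atlas_smooth : forall c1 c2, atlas c1 -> atlas c2 ->
    forall j : 'I_n,
      smooth_on (overlap c1 c2) (fun x => transition c1 c2 x 0 j)
}.

(* Tensor fields are given by their components in each chart of the atlas, as
   functions of the coordinates [x], subject to the tensorial transformation
   law; the values outside [chart_cod] are irrelevant. *)
Record riemannian_metric (R : realType) (n : nat) (M : smooth_manifold R n) :=
  RiemannianMetric {
  metric :> chart R n M -> 'rV[R]_n -> 'M[R]_n;
  metric_smooth : forall c, atlas c ->
    forall i j : 'I_n, smooth_on (chart_cod c) (fun x => metric c x i j);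
  metric_sym : forall c x, atlas c -> chart_cod c x ->
    (metric c x)^T = metric c x;
  metric_pos : forall c x, atlas c -> chart_cod c x ->
    forall y : 'rV[R]_n, y != 0 -> 0 < (y *m metric c x *m y^T) 0 0;
  metric_transition : forall c1 c2 x, atlas c1 -> atlas c2 ->
    overlap c1 c2 x ->
    metric c1 x = jacobian_mx c1 c2 x *m metric c2 (transition c1 c2 x)
                    *m (jacobian_mx c1 c2 x)^T
}.

Record one_form (R : realType) (n : nat) (M : smooth_manifold R n) :=
  OneForm {
  form :> chart R n M -> 'rV[R]_n -> 'rV[R]_n;
  form_smooth : forall c, atlas c ->
    forall i : 'I_n, smooth_on (chart_cod c) (fun x => form c x 0 i);
  form_transition : forall c1 c2 x, atlas c1 -> atlas c2 ->
    overlap c1 c2 x ->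
    form c1 x = form c2 (transition c1 c2 x) *m (jacobian_mx c1 c2 x)^T
}.

Section Riemannian.
Context {R : realType} {n : nat} {M : smooth_manifold R n}.
Variables (gamma : riemannian_metric M) (b : one_form M).
Implicit Types (c : chart R n M) (x y : 'rV[R]_n).

Definition form_norm2 c x : R :=
  \sum_(i < n) \sum_(j < n) invmx (gamma c x) i j * b c x 0 i * b c x 0 j.

Definition unit_form : Prop :=
  forall c x, atlas c -> chart_cod c x -> form_norm2 c x = 1.

Definition christoffel c (k i j : 'I_n) x : R :=
  2^-1 * \sum_(l < n) invmx (gamma c x) k l *
    (partial i (fun z => gamma c z j l) x + partial j (fun z => gamma c z i l) x
     - partial l (fun z => gamma c z i j) x).

Definition nabla_form c (i j : 'I_n) x : R :=
  partial i (fun z => b c z 0 j) x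
  - \sum_(k < n) christoffel c k i j x * b c x 0 k.

Definition parallel_form : Prop :=
  forall c x, atlas c -> chart_cod c x -> forall i j, nabla_form c i j x = 0.

Definition metric_quad c x y : R :=
  \sum_(i < n) \sum_(j < n) gamma c x i j * y 0 i * y 0 j.

Definition form_lin c x y : R := \sum_(i < n) b c x 0 i * y 0 i.

Definition cubic c x y : R := metric_quad c x y * form_lin c x y.

End Riemannian.

(* The real cube root, of the same sign as its argument. *)
Definition cube_root {R : realType} (t : R) : R :=
  Num.sg t * `|t| `^ (3^-1).

(* Functions on (subsets of) TM, in the coordinates (x, y) induced by one
   chart. *)
Section LocalFinsler.
Context {R : realType} {n : nat}.
Implicit Types (L F T : 'rV[R]_n -> 'rV[R]_n -> R) (x y : 'rV[R]_n).

Definition dx (k : 'I_n) L x y : R := partial k (fun z => L z y) x.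
Definition dy (k : 'I_n) L x y : R := partial k (L x) y.

Definition hessian_y L x y : 'M[R]_n := \matrix_(i, j) dy i (dy j L) x y.

(* The zero section is excluded automatically as soon as [T x 0 = 0]. *)
Definition regular_dom T x y : Prop :=
  T x y != 0 /\ hessian_y T x y \in unitmx.

Definition sqr_fun F x y : R := F x y ^+ 2.

Definition finsler_metric F x y : 'M[R]_n := 2^-1 *: hessian_y (sqr_fun F) x y.

(* Half of the right-hand side of the formula for 2 G^i. *)
Definition spray F (i : 'I_n) x y : R :=
  2^-1 * (2^-1 * \sum_(h < n) invmx (finsler_metric F x y) i h *
    (\sum_(k < n) dy h (dx k (sqr_fun F)) x y * y 0 k
     - dx h (sqr_fun F) x y)).

Definition berwald_connection F (i j k : 'I_n) x y : R :=
  dy j (dy k (spray F i)) x y.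

End LocalFinsler.

(* [F] and the domain [D] are given in the induced coordinates of each chart. *)
Definition berwald_type (R : realType) (n : nat) (M : smooth_manifold R n)
    (D : chart R n M -> 'rV[R]_n -> 'rV[R]_n -> Prop)
    (F : chart R n M -> 'rV[R]_n -> 'rV[R]_n -> R) : Prop :=
  forall c, atlas c ->
  forall i j k : 'I_n, exists Gamma : 'rV[R]_n -> R,
  forall x y, chart_cod c x -> D c x y ->
    berwald_connection (F c) i j k x y = Gamma x.

(* Main.v *)
(* Write T = a b.  By homogeneity the Euler-Lagrange equations of F^2 = T^(2/3)
   reduce, on the regular domain, to T_yy (2 G) = E, where
   E_h = sum_k T_{y^h x^k} y^k - T_{x^h} is cubic in y.

   If F is of Berwald type, 2 G^i = S^i_jk y^j y^k with a symmetric connection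
   S, and the equation becomes a polynomial identity, hence holds for all y.  In
   terms of the S-covariant derivatives R_k(y) of T it says
   sum_k y^k dR_k/dy^h = R_h.  Contracting with y^h gives sum_k y^k R_k = 0;
   differentiating this and comparing gives R_h = 0.  Thus
   (S-derivative of a) b + a (S-derivative of b) = 0; restricting it to ker b,
   where a > 0, the S-derivative of b is mu b, and evaluating at the metric dual of
   b, where |b| = 1 forces (D a)(v, v) = 2 (D b)(v), gives mu = 0.  So S preserves
   a, hence is the Levi-Civita connection, and preserves b.

   Conversely, if b is parallel then all R_k vanish for the Levi-Civita
   connection, so its quadratic spray solves T_yy (2 G) = E. *)
Require Import Defs.
From HB Require Import structures.
From mathcomp Require Import all_boot all_order all_algebra.
From mathcomp Require Import all_classical all_reals all_analysis.
From mathcomp Require Import ring lra.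

Set Implicit Arguments.
Unset Strict Implicit.
Unset Printing Implicit Defensive.

Import Order.TTheory GRing.Theory Num.Theory.
Import numFieldNormedType.Exports.

Local Open Scope classical_set_scope.
Local Open Scope ring_scope.

(** * Differential calculus on row vectors *)

Section Differentials.
Context {R : realType} {n : nat}.
Local Notation V := 'rV[R]_n.
Implicit Types (f g df dg : V -> R) (x v : V).

Lemma partial_diff f df x i : is_diff x f df -> partial i f x = df (delta_mx 0 i).
Proof. by move=> [fx <-]; rewrite /partial deriveE. Qed.

Lemma is_diff_ext f g df dg x :
  is_diff x f df -> f =1 g -> df =1 dg -> is_diff x g dg.
Proof. by move=> + /funext <- /funext <-. Qed.

Lemma is_diff_add f g df dg x : is_diff x f df -> is_diff x g dg ->
  is_diff x (fun z => f z + g z) (fun v => df v + dg v).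
Proof. by move=> Df Dg; have := is_diffD Df Dg. Qed.

Lemma is_diff_mul f g df dg x : is_diff x f df -> is_diff x g dg ->
  is_diff x (fun z => f z * g z) (fun v => f x * dg v + g x * df v).
Proof. by move=> Df Dg; have := is_diffM Df Dg. Qed.

Lemma is_diff_const (c : R) x : is_diff x (fun=> c) (fun=> 0).
Proof. exact: is_diff_cst. Qed.

Lemma is_diff_scale c f df x : is_diff x f df ->
  is_diff x (fun z => c * f z) (fun v => c * df v).
Proof. by move=> Df; have := is_diffZ c Df. Qed.

Lemma is_diff_sum (I : Type) (r : seq I) (F dF : I -> V -> R) x :
  (forall i, is_diff x (F i) (dF i)) ->
  is_diff x (fun z => \sum_(i <- r) F i z) (fun v => \sum_(i <- r) dF i v).
Proof.
move=> DF; elim: r => [|i r IH].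
  by apply: is_diff_ext (is_diff_const 0 x) _ _ => z; rewrite big_nil.
by apply: is_diff_ext (is_diff_add (DF i) IH) _ _ => z; rewrite big_cons.
Qed.

Lemma is_diff_coord i x : is_diff x (fun z : V => z 0 i) (fun v => v 0 i).
Proof.
pose f : V -> R := fun z => z 0 i.
have flin : linear f by move=> a u v; rewrite /f !mxE.
pose fM := GRing.isLinear.Build _ _ _ _ _ flin.
pose fL : {linear V -> R^o} := HB.pack f fM.
have fc : continuous fL by apply: coord_continuous.
apply: DiffDef; first exact: (@linear_differentiable R V R^o fL x fc).
exact: (@diff_lin R V R^o fL x fc).
Qed.

Lemma is_diff_line f df x (h : R -> R) (dh : R) : is_diff x f df ->
  is_derive (f x) 1 h dh -> is_diff x (fun z => h (f z)) (fun v => df v * dh).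
Proof.
move=> [fx dfE] [hd dhE].
have hx : differentiable h (f x) by apply/derivable1_diffP.
apply: DiffDef; first exact: (differentiable_comp fx hx).
rewrite (diff_comp fx hx) dfE; apply/funext => v /=.
by rewrite (diff1E hx) derive1E dhE.
Qed.

Lemma is_diff_differentiable f x : differentiable f x ->
  is_diff x f (fun v => \sum_(i < n) v 0 i * partial i f x).
Proof.
move=> fx; apply: DiffDef => //; apply/funext => v.
rewrite {1}[v]row_sum_delta linear_sum; apply: eq_bigr => i _ /=.
by rewrite linearZ /partial deriveE.
Qed.

Lemma sum_delta_rV (c : 'I_n -> R) k : \sum_i (delta_mx 0 k : V) 0 i * c i = c k.
Proof.
rewrite (bigD1 k) //= mxE !eqxx mul1r big1 ?addr0 // => i ik.
by rewrite mxE (negPf ik) andbF mul0r.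
Qed.

(** The first-order expansion at [x] only involves values near [x], and it determines the
    differential. *)
Lemma is_diff_near f g df x : (\near x, f x = g x) ->
  is_diff x f df -> is_diff x g df.
Proof.
move=> fg [fx <-].
have gE : g \o shift x = cst (g x) + 'd f x +o_ (0 : V) id.
  apply/eqaddoP => e e0.
  have /eqaddoP/(_ _ e0) := diff_locally fx.
  have : \forall h \near (0 : V), f (h + x) = g (h + x).
    by move: fg; rewrite (near_shift 0) /= subr0.
  apply: filterS2 => h /= fgh; rewrite !fctE /= fgh.
  by rewrite (nbhs_singleton fg).
have dfc : continuous ('d f x) by exact: diff_continuous fx.
have dgE : 'd g x = 'd f x :> (V -> R) by apply: diff_unique.
apply: DiffDef; last exact: dgE.
by apply/diff_locallyP; rewrite dgE; split.
Qed.

Lemma differentiable_near f g x : (\near x, f x = g x) ->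
  differentiable f x -> differentiable g x.
Proof. by move=> fg /is_diff_differentiable /(is_diff_near fg) []. Qed.

Lemma partial_near f g x i : (\near x, f x = g x) ->
  partial i f x = partial i g x.
Proof. exact: near_eq_derive. Qed.

(* [f] is k + 1 times differentiable at the points of [U]. *)
Fixpoint diffn (k : nat) (U : set V) f : Prop :=
  (forall x, U x -> differentiable f x) /\
  (if k is k'.+1 then forall i, diffn k' U (partial i f) else True).

Lemma diffn_differentiable k U f x : diffn k U f -> U x -> differentiable f x.
Proof. by case: k => [|k] fU; exact: fU.1. Qed.

Lemma diffn_partial k U f i : diffn k.+1 U f -> diffn k U (partial i f).
Proof. by move=> fU; exact: fU.2. Qed.

Lemma diffnW k U f : diffn k.+1 U f -> diffn k U f.
Proof.
elim: k f => [|k IH] f [fU pf]; split=> // i.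
exact/IH/pf.
Qed.

Lemma smooth_on_diffn k U f : smooth_on U f -> diffn k U f.
Proof.
elim: k f => [|k IH] f fU; split=> //; try by move=> x; exact: (fU [::]).
move=> i; apply: IH => s x Ux.
(* [foldr] applies the last entry of the sequence first, hence [rcons]. *)
by have := fU (rcons s i) x Ux; rewrite /iter_partial foldr_rcons.
Qed.

Section OpenDomain.
Variables (U : set V) (oU : open U).

Lemma near_open (P : V -> Prop) x : U x -> (forall z, U z -> P z) ->
  \near x, P x.
Proof. by move=> Ux UP; apply: filterS UP _; exact: open_nbhs_nbhs. Qed.

(** Since [U] is open, equality on [U] is equality near each of its points and passes to partial
    derivatives. *)
Lemma diffn_ext k f g : (forall x, U x -> f x = g x) ->
  diffn k U f -> diffn k U g.
Proof.
elim: k f g => [|k IH] f g fg [fU pf]; split=> //.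
- by move=> x Ux; apply: differentiable_near (near_open Ux fg) (fU x Ux).
- by move=> x Ux; apply: differentiable_near (near_open Ux fg) (fU x Ux).
- move=> i; apply: IH (pf i) => x Ux.
  exact: partial_near (near_open Ux fg).
Qed.

Lemma diffn_const k c : diffn k U (fun=> c).
Proof.
elim: k c => [|k IH] c; split=> //; try by move=> x _; exact: differentiable_cst.
move=> i; apply: diffn_ext (IH 0) => x _.
by rewrite (partial_diff i (is_diff_const c x)).
Qed.

Lemma diffn_coord k j : diffn k U (fun x => x 0 j).
Proof.
case: k => [|k]; split=> //; try by move=> x _; exact: differentiable_coord.
move=> i; apply: diffn_ext (diffn_const k (delta_mx 0 i 0 j)) => x _.
by rewrite (partial_diff i (is_diff_coord j x)).
Qed.

Lemma diffn_add k f g : diffn k U f -> diffn k U g ->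
  diffn k U (fun x => f x + g x).
Proof.
elim: k f g => [|k IH] f g [fU pf] [gU pg]; split=> //;
  try by move=> x Ux; exact: differentiableD (fU x Ux) (gU x Ux).
move=> i; apply: diffn_ext (IH _ _ (pf i) (pg i)) => x Ux.
rewrite (partial_diff i (is_diff_add (is_diff_differentiable (fU x Ux))
  (is_diff_differentiable (gU x Ux)))).
by rewrite -!(partial_diff i (is_diff_differentiable _)) //; [exact: gU|exact: fU].
Qed.

Lemma diffn_mul k f g : diffn k U f -> diffn k U g ->
  diffn k U (fun x => f x * g x).
Proof.
elim: k f g => [|k IH] f g fU gU; split=> //;
  try by move=> x Ux; exact: differentiableM (fU.1 x Ux) (gU.1 x Ux).
move=> i; apply: diffn_ext (diffn_add (IH _ _ (diffnW fU) (gU.2 i))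
  (IH _ _ (diffnW gU) (fU.2 i))) => x Ux.
have Df := is_diff_differentiable (fU.1 x Ux).
have Dg := is_diff_differentiable (gU.1 x Ux).
by rewrite (partial_diff i (is_diff_mul Df Dg)) (partial_diff i Df) (partial_diff i Dg).
Qed.

(** The partial derivatives of $1/f$ are $-(1/f)^2\,\partial_i f$, so each order of
    differentiability of $1/f$ yields the next. *)
Lemma diffn_inv k f : diffn k U f -> (forall x, U x -> f x != 0) ->
  diffn k U (fun x => (f x)^-1).
Proof.
move=> fU f0; elim: k fU => [|k IH] fU; split=> //;
  try by move=> x Ux; exact: differentiableV (fU.1 x Ux) (f0 x Ux).
move=> i; have fV := IH (diffnW fU).
apply: diffn_ext (diffn_mul (diffn_const k (-1))
  (diffn_mul (diffn_mul fV fV) (fU.2 i))) => x Ux.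
rewrite mulN1r /partial deriveV ?f0 //; last exact/diff_derivable/(fU.1 x Ux).
by rewrite scaleNr /GRing.scale /= expr2 invfM.
Qed.

Lemma diffn_sum k (I : Type) (r : seq I) (F : I -> V -> R) :
  (forall i, diffn k U (F i)) -> diffn k U (fun x => \sum_(i <- r) F i x).
Proof.
move=> FU; elim: r => [|i r IH].
  by apply: diffn_ext (diffn_const k 0) => x _; rewrite big_nil.
by apply: diffn_ext (diffn_add (FU i) IH) => x _; rewrite big_cons.
Qed.

Lemma diffn_prod k (I : Type) (r : seq I) (F : I -> V -> R) :
  (forall i, diffn k U (F i)) -> diffn k U (fun x => \prod_(i <- r) F i x).
Proof.
move=> FU; elim: r => [|i r IH].
  by apply: diffn_ext (diffn_const k 1) => x _; rewrite big_nil.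
by apply: diffn_ext (diffn_mul (FU i) IH) => x _; rewrite big_cons.
Qed.

Lemma diffn_det k m (A : V -> 'M[R]_m) :
  (forall i j, diffn k U (fun x => A x i j)) -> diffn k U (fun x => \det (A x)).
Proof.
move=> AU; apply: diffn_sum => s; apply: diffn_mul; first exact: diffn_const.
by apply: diffn_prod.
Qed.

(** Cramer's rule writes the entries as cofactors over the determinant. *)
Lemma diffn_invmx k m (A : V -> 'M[R]_m) :
  (forall i j, diffn k U (fun x => A x i j)) ->
  (forall x, U x -> A x \in unitmx) ->
  forall i j, diffn k U (fun x => invmx (A x) i j).
Proof.
move=> AU uA i j.
apply: (@diffn_ext _ (fun x => (\det (A x))^-1 * cofactor (A x) j i)).
  by move=> x Ux; rewrite /invmx uA // !mxE.
apply: diffn_mul.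
  by apply: diffn_inv (diffn_det AU) _ => x Ux; rewrite -unitfE -unitmxE uA.
apply: diffn_mul; first exact: diffn_const.
by apply: diffn_det => a b; apply: diffn_ext (AU (lift j a) (lift i b)) => x _;
  rewrite !mxE.
Qed.

End OpenDomain.

End Differentials.

(** * The function $t^{2/3}$ and its derivatives *)

Section CubeRootSquared.
Context {R : realType}.
Implicit Types t : R.

(** This is $r(t)=t^{2/3}$, so that $F^2=r(T)$. Its derivative is written as a multiple of $r(t)/t$,
    which keeps later computations within field identities. *)
Definition sqr_cbrt t : R := cube_root t ^+ 2.
Definition sqr_cbrt' t : R := 2 / 3 * sqr_cbrt t / t.

(* Away from 0 this single formula covers both signs of [t]. *)
Lemma sqr_cbrtE t : t != 0 -> sqr_cbrt t = expR (3^-1 * ln (t ^+ 2)).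
Proof.
move=> t0; rewrite /sqr_cbrt /cube_root exprMn sqr_sg t0 mul1r.
rewrite /powR normr_eq0 (negPf t0) -expRM_natl.
have -> : ln (t ^+ 2) = 2 * ln `|t|.
  by rewrite -[t ^+ 2]ger0_norm ?sqr_ge0 // normrX lnXn ?normr_gt0 // mulr_natl.
congr expR; ring.
Qed.

Lemma sqr_cbrt_gt0 t : t != 0 -> 0 < sqr_cbrt t.
Proof. by move=> t0; rewrite sqr_cbrtE // expR_gt0. Qed.

Lemma sqr_cbrt'_neq0 t : t != 0 -> sqr_cbrt' t != 0.
Proof.
move=> t0; rewrite /sqr_cbrt'; have := sqr_cbrt_gt0 t0; move: (sqr_cbrt t) => r r0.
by rewrite !mulf_neq0 ?invr_neq0 ?pnatr_eq0 // gt_eqF.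
Qed.

Lemma is_derive_sqr_cbrt t : t != 0 -> is_derive t 1 sqr_cbrt (sqr_cbrt' t).
Proof.
move=> t0.
have t2 : 0 < t ^+ 2 by rewrite exprn_even_gt0.
have sq : is_derive t 1 (fun u : R => u ^+ 2) (t *+ 2).
  by have := is_deriveX 2 (is_derive_id t (1 : R)); rewrite /= expr1 scaler1 mulr_natl.
have lnsq : is_derive t 1 (fun u : R => ln (u ^+ 2)) ((t ^+ 2)^-1 * (t *+ 2)).
  exact: (@is_derive1_comp _ (@ln R) (fun u => u ^+ 2) t _ _ (is_derive1_ln t2) sq).
have D : is_derive t 1 (fun u : R => expR (3^-1 * ln (u ^+ 2)))
    (expR (3^-1 * ln (t ^+ 2)) * (3^-1 * ((t ^+ 2)^-1 * (t *+ 2)))).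
  exact: (@is_derive1_comp _ (@expR R) (fun u => 3^-1 * ln (u ^+ 2)) t _ _
    (is_derive_expR _) (is_deriveZ 3^-1 lnsq)).
apply: is_derive_eq (near_eq_is_derive _ D) _.
  have : \near t, t != 0 by apply: open_nbhs_nbhs; split=> //; exact: open_neq.
  by apply: filterS => u u0; rewrite sqr_cbrtE.
by rewrite /sqr_cbrt' -sqr_cbrtE //; field.
Qed.

(** In terms of $r(t)=t^{2/3}$ this is $r''=-r'/(3t)$, from the product rule for $\frac23 r(t)\cdot
    t^{-1}$. *)
Lemma is_derive_sqr_cbrt' t : t != 0 ->
  is_derive t 1 sqr_cbrt' (- sqr_cbrt' t / (3 * t)).
Proof.
move=> t0; have D := is_derive_sqr_cbrt t0.
have DV : is_derive t 1 (fun u : R => u^-1) (- t ^- 2).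
  have := @is_deriveV _ (fun u : R => u) t 1 1 t0 (is_derive_id t 1).
  by rewrite [_ *: _]mulr1.
apply: is_derive_eq (is_deriveM (is_deriveZ (2 / 3) D) DV) _.
rewrite /sqr_cbrt' /=; have -> : (2 / 3) *: sqr_cbrt t = 2 / 3 * sqr_cbrt t by [].
by rewrite /GRing.scale /=; field.
Qed.

End CubeRootSquared.

(** * The cubic form and its derivatives in the fibre *)

Section Forms.
Context {R : realType} {n : nat}.
Implicit Types (g : 'M[R]_n) (a x y z v w : 'rV[R]_n).

Definition qf g y z : R := \sum_(i < n) \sum_(j < n) g i j * y 0 i * z 0 j.
Definition lf a y : R := \sum_(i < n) a 0 i * y 0 i.

Lemma qfE g y z : qf g y z = (y *m g *m z^T) 0 0.
Proof.
rewrite mxE /qf exchange_big /=; apply: eq_bigr => j _.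
rewrite !mxE mulr_suml; apply: eq_bigr => i _; ring.
Qed.

Lemma lfE a y : lf a y = (a *m y^T) 0 0.
Proof. by rewrite mxE; apply: eq_bigr => i _; rewrite mxE. Qed.

Lemma qfC g y z : g^T = g -> qf g y z = qf g z y.
Proof.
move=> gT; rewrite /qf exchange_big /=; apply: eq_bigr => i _.
apply: eq_bigr => j _; rewrite -{1}gT mxE; ring.
Qed.

Lemma qfDl g y z w : qf g (y + z) w = qf g y w + qf g z w.
Proof. by rewrite !qfE !mulmxDl mxE. Qed.

Lemma qfDr g w y z : qf g w (y + z) = qf g w y + qf g w z.
Proof. by rewrite !qfE linearD mulmxDr mxE. Qed.

Lemma qfZl g c y z : qf g (c *: y) z = c * qf g y z.
Proof. by rewrite !qfE -!scalemxAl mxE. Qed.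

Lemma qfZr g c y z : qf g y (c *: z) = c * qf g y z.
Proof. by rewrite !qfE linearZ -scalemxAr mxE. Qed.

Lemma qf0r g y : qf g y 0 = 0.
Proof. by rewrite !qfE trmx0 mulmx0 mxE. Qed.

Lemma qf_sumr (I : finType) g y (c : I -> R) (z : I -> 'rV[R]_n) :
  qf g y (\sum_i c i *: z i) = \sum_i c i * qf g y (z i).
Proof.
elim/big_rec2: _ => [|i s t _ <-]; first exact: qf0r.
by rewrite qfDr qfZr.
Qed.

Lemma qfB_mx g g' y z : qf (g - g') y z = qf g y z - qf g' y z.
Proof. by rewrite !qfE mulmxBr mulmxBl !mxE. Qed.

Lemma lfD a y z : lf a (y + z) = lf a y + lf a z.
Proof. by rewrite !lfE linearD mulmxDr mxE. Qed.

Lemma lfZ a c y : lf a (c *: y) = c * lf a y.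
Proof. by rewrite !lfE linearZ -scalemxAr mxE. Qed.

Lemma lf_sum (I : finType) a (c : I -> R) (z : I -> 'rV[R]_n) :
  lf a (\sum_i c i *: z i) = \sum_i c i * lf a (z i).
Proof.
elim/big_rec2: _ => [|i s t _ <-]; first by rewrite lfE trmx0 mulmx0 mxE.
by rewrite lfD lfZ.
Qed.

Lemma lfB_form a a' y : lf (a - a') y = lf a y - lf a' y.
Proof. by rewrite !lfE mulmxBl !mxE. Qed.

Lemma lf_delta a i : lf a (delta_mx 0 i) = a 0 i.
Proof. by rewrite lfE trmx_delta -colE mxE. Qed.

Lemma qf0_mx y z : qf 0 y z = 0.
Proof. by rewrite qfE mulmx0 mul0mx mxE. Qed.

Lemma lf0_form y : lf 0 y = 0.
Proof. by rewrite lfE mul0mx mxE. Qed.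

Lemma qf_delta g i j : qf g (delta_mx 0 i) (delta_mx 0 j) = g i j.
Proof. by rewrite qfE trmx_delta -rowE -colE !mxE. Qed.

Definition cub g a y : R := qf g y y * lf a y.
(** For symmetric [g], [dcub] and [hcub] are the first and second fibre derivatives of [cub] at [y],
    in the directions [v] and [v], [w]. *)
Definition dcub g a y v : R := 2 * qf g y v * lf a y + qf g y y * lf a v.
Definition hcub g a y v w : R :=
  2 * (qf g v w * lf a y + qf g y v * lf a w + qf g y w * lf a v).

(* First variation of [cub] and [dcub] in the coefficients [(g, a)]. *)
Definition var_cub g a dg da y : R := cub dg a y + cub g da y.
Definition var_dcub g a dg da y v : R := dcub dg a y v + dcub g da y v.
(** The expression $E_h=\sum_k T_{y^hx^k}y^k-T_{x^h}$, with the $x$-derivatives of the coefficients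
    left as free arguments so that covariant derivatives can take their place. *)
Definition euler_cub g a (dg : 'I_n -> 'M[R]_n) (da : 'I_n -> 'rV[R]_n) h y : R :=
  \sum_k var_dcub g a (dg k) (da k) y (delta_mx 0 h) * y 0 k
  - var_cub g a (dg h) (da h) y.

Lemma dcub_sum (I : finType) g a y (c : I -> R) (z : I -> 'rV[R]_n) :
  dcub g a y (\sum_i c i *: z i) = \sum_i c i * dcub g a y (z i).
Proof.
rewrite /dcub qf_sumr lf_sum mulr_sumr mulr_suml mulr_sumr -big_split /=.
by apply: eq_bigr => i _; ring.
Qed.

Lemma hcub_sum (I : finType) g a y v (c : I -> R) (z : I -> 'rV[R]_n) :
  hcub g a y v (\sum_i c i *: z i) = \sum_i c i * hcub g a y v (z i).
Proof.
rewrite /hcub !qf_sumr lf_sum 2!mulr_suml mulr_sumr -!big_split /= mulr_sumr.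
by apply: eq_bigr => i _; ring.
Qed.

Lemma hcubC g a y v w : g^T = g -> hcub g a y v w = hcub g a y w v.
Proof. by move=> gT; rewrite /hcub (qfC v w gT); ring. Qed.

Lemma dcub_self g a y : dcub g a y y = 3 * cub g a y.
Proof. rewrite /dcub /cub; ring. Qed.

Lemma hcub_self g a y v : g^T = g -> hcub g a y v y = 2 * dcub g a y v.
Proof. by move=> gT; rewrite /dcub /hcub (qfC v y gT); ring. Qed.

Lemma is_diff_lf a y : is_diff y (lf a) (lf a).
Proof. by apply: is_diff_sum => i; apply/is_diff_scale/is_diff_coord. Qed.

Lemma is_diff_qf g y z : is_diff y (qf g z) (qf g z).
Proof.
apply: is_diff_sum => i; apply: is_diff_sum => j.
exact/is_diff_scale/is_diff_coord.
Qed.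

Lemma is_diff_quad g y : g^T = g ->
  is_diff y (fun y => qf g y y) (fun v => 2 * qf g y v).
Proof.
move=> gT.
have D i j : is_diff y (fun z => g i j * z 0 i * z 0 j)
  (fun v => g i j * y 0 i * v 0 j + y 0 j * (g i j * v 0 i)).
  exact: (is_diff_mul (is_diff_scale _ (is_diff_coord i y)) (is_diff_coord j y)).
apply: is_diff_ext (is_diff_sum _ (fun i => is_diff_sum _ (D i))) _ _ => v //.
rewrite mulr_natl mulr2n {2}(qfC y v gT) /qf -big_split /=; apply: eq_bigr => i _.
by rewrite -big_split; apply: eq_bigr => j _ /=; ring.
Qed.

Lemma is_diff_cub g a y : g^T = g -> is_diff y (cub g a) (dcub g a y).
Proof.
move=> gT; apply: is_diff_ext (is_diff_mul (is_diff_quad y gT) (is_diff_lf a y)) _ _.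
  by [].
by move=> v; rewrite /dcub; ring.
Qed.

Lemma is_diff_var_cub g a dg da y : g^T = g -> dg^T = dg ->
  is_diff y (var_cub g a dg da) (var_dcub g a dg da y).
Proof. by move=> gT dgT; apply: is_diff_add; exact: is_diff_cub. Qed.

Lemma is_diff_dcub g a y v : g^T = g ->
  is_diff y (fun y => dcub g a y v) (hcub g a y v).
Proof.
move=> gT; have D := is_diff_add (is_diff_scale 2 (is_diff_mul (is_diff_qf g y v)
  (is_diff_lf a y))) (is_diff_scale (lf a v) (is_diff_quad y gT)).
apply: is_diff_ext D _ _ => w; rewrite /dcub /hcub; last by rewrite (qfC v y gT); ring.
by rewrite (qfC v w gT); ring.
Qed.

End Forms.

(** * Invertibility of matrices *)

Section LinearAlgebra.
Context {R : realType} {n : nat}.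
Implicit Types (H M : 'M[R]_n) (u v y : 'rV[R]_n).

Lemma unitmx_inj M : (forall v : 'rV_n, v *m M = 0 -> v = 0) -> M \in unitmx.
Proof.
move=> Minj; rewrite -row_free_unit -kermx_eq0; apply/rowV0P => v /sub_kermxP.
exact: Minj.
Qed.

(* With [r = T], [H = T_yy] and [t = T_y], this makes the Finsler metric invertible. *)
Lemma unitmx_rank1 H y t (r p : R) : H \in unitmx -> p != 0 -> r != 0 ->
  y *m H = 2 *: t -> (y *m t^T) 0 0 = 3 * r ->
  p *: H - (p / (3 * r)) *: (t^T *m t) \in unitmx.
Proof.
move=> uH p0 r0 yH yt; apply: unitmx_inj => v.
rewrite mulmxBr -!scalemxAr mulmxA [v *m t^T]mx11_scalar mul_scalar_mx.
set c := (v *m t^T) 0 0 => /eqP; rewrite subr_eq0 => /eqP vH.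
(* Since [y *m H] is [2 *: t], a kernel vector is a multiple of [y]; pairing it with [t] then forces
   [c = c / 2]. *)
have {}vH : v *m H = (c / (6 * r)) *: y *m H.
  rewrite -scalemxAl yH scalerA; apply: (scalerI p0); rewrite vH !scalerA.
  by congr (_ *: _); field.
have {}vH : v = (c / (6 * r)) *: y by rewrite -(mulmxK uH v) vH mulmxK.
have c0 : c = 0.
  have : c = c / 2 by rewrite {1}/c vH -scalemxAl mxE yt; field.
  lra.
by rewrite vH c0 mul0r scale0r.
Qed.

End LinearAlgebra.

(** * The spray of the cube root of a cubic *)

Section LocalSpray.
Context {R : realType} {n : nat}.
Local Notation V := 'rV[R]_n.
Variables (g : V -> 'M[R]_n) (a : V -> V) (x : V).
Implicit Types y u : V.

Definition partial_mx k : 'M[R]_n := \matrix_(i, j) partial k (fun z => g z i j) x.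
Definition partial_rV k : V := \row_i partial k (fun z => a z 0 i) x.

Hypothesis g_diff : forall i j, differentiable (fun z => g z i j) x.
Hypothesis a_diff : forall i, differentiable (fun z => a z 0 i) x.
Hypothesis g_sym : (g x)^T = g x.
Hypothesis dg_sym : forall k, (partial_mx k)^T = partial_mx k.

Local Notation T := (fun z y => cub (g z) (a z) y).
Local Notation L := (sqr_fun (fun z y => cube_root (cub (g z) (a z) y))).
Local Notation e i := (delta_mx 0 i : V).

Local Notation cub_x k := (var_cub (g x) (a x) (partial_mx k) (partial_rV k)).
Local Notation dcub_x k := (var_dcub (g x) (a x) (partial_mx k) (partial_rV k)).
Local Notation euler := (euler_cub (g x) (a x) partial_mx partial_rV).

Lemma dx_cub y : differentiable (T^~ y) x /\
  forall k, partial k (T^~ y) x = cub_x k y.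
Proof.
have Dq : is_diff x (fun z => qf (g z) y y) (fun v => \sum_i \sum_j
    y 0 j * (y 0 i * (\sum_k v 0 k * partial k (fun z => g z i j) x))).
  have D i j := is_diff_scale (y 0 j) (is_diff_scale (y 0 i)
    (is_diff_differentiable (g_diff i j))).
  apply: is_diff_ext (is_diff_sum _ (fun i => is_diff_sum _ (D i))) _ _ => z //.
  by apply: eq_bigr => i _; apply: eq_bigr => j _; ring.
have Dl : is_diff x (fun z => lf (a z) y) (fun v => \sum_i
    y 0 i * (\sum_k v 0 k * partial k (fun z => a z 0 i) x)).
  have D i := is_diff_scale (y 0 i) (is_diff_differentiable (a_diff i)).
  apply: is_diff_ext (is_diff_sum _ D) _ _ => z //.
  by apply: eq_bigr => i _; ring.
have D := is_diff_mul Dq Dl.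
split=> [|k]; first by case: D.
rewrite (partial_diff k D) /var_cub /cub addrC; congr (_ + _).
  rewrite mulrC; congr (_ * _); apply: eq_bigr => i _; apply: eq_bigr => j _.
  by rewrite sum_delta_rV mxE; ring.
by congr (_ * _); apply: eq_bigr => i _; rewrite sum_delta_rV mxE; ring.
Qed.

Lemma dx_sqr k y : T x y != 0 -> dx k L x y = sqr_cbrt' (T x y) * cub_x k y.
Proof.
move=> Ty0; have [/is_diff_differentiable D DE] := dx_cub y.
rewrite /dx (partial_diff k (is_diff_line D (is_derive_sqr_cbrt Ty0))).
by rewrite -(partial_diff k D) DE mulrC.
Qed.

Lemma dy_sqr j y : T x y != 0 -> dy j L x y = sqr_cbrt' (T x y) * dcub (g x) (a x) y (e j).
Proof.
move=> Ty0; have D := is_diff_cub (a x) y g_sym.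
by rewrite /dy (partial_diff j (is_diff_line D (is_derive_sqr_cbrt Ty0))) mulrC.
Qed.

(** Formulas that hold only where $T\neq0$ hold near such a point, and can therefore be
    differentiated again in $y$. *)
Lemma near_cub_neq0 y : T x y != 0 -> \near y, T x y != 0.
Proof.
move=> Ty0; have [D _] := is_diff_cub (a x) y g_sym.
have N : nbhs (T x y) [set t | t != 0].
  by apply: open_nbhs_nbhs; split=> //; exact: open_neq.
exact: (differentiable_continuous D N).
Qed.

Lemma is_diff_sqr_cbrt'_cub y : T x y != 0 -> is_diff y (fun y => sqr_cbrt' (T x y))
  (fun v => dcub (g x) (a x) y v * (- sqr_cbrt' (T x y) / (3 * T x y))).
Proof.
move=> Ty0; have D := is_diff_cub (a x) y g_sym.
exact: is_diff_line D (is_derive_sqr_cbrt' Ty0).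
Qed.

Lemma dy_dx_sqr h k y : T x y != 0 -> dy h (dx k L) x y =
  sqr_cbrt' (T x y) * dcub_x k y (e h)
  - sqr_cbrt' (T x y) / (3 * T x y) * dcub (g x) (a x) y (e h) * cub_x k y.
Proof.
move=> Ty0; have D := is_diff_mul (is_diff_sqr_cbrt'_cub Ty0)
  (is_diff_var_cub (a x) (partial_rV k) y g_sym (dg_sym k)).
rewrite /dy (@partial_near _ _ _ (fun y => sqr_cbrt' (T x y) * cub_x k y)).
  by rewrite (partial_diff h D) /=; ring.
by apply: filterS (near_cub_neq0 Ty0) => z Tz0; rewrite dx_sqr.
Qed.

Lemma hessian_cub y i j : hessian_y T x y i j = hcub (g x) (a x) y (e j) (e i).
Proof.
rewrite mxE -(partial_diff i (is_diff_dcub (a x) y (e j) g_sym)) /dy.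
congr partial; apply/funext => z.
exact: partial_diff (is_diff_cub (a x) z g_sym).
Qed.

(** Differentiating $r'(T)T_{y^j}$ gives $r'T_{yy}$ plus the rank-one term $r''T_y^tT_y$, where
    $r''=-r'/(3T)$. *)
Lemma hessian_sqr y : T x y != 0 -> hessian_y L x y =
  sqr_cbrt' (T x y) *: hessian_y T x y - (sqr_cbrt' (T x y) / (3 * T x y)) *:
   ((\row_i dcub (g x) (a x) y (e i))^T *m \row_i dcub (g x) (a x) y (e i)).
Proof.
move=> Ty0; apply/matrixP => i j.
rewrite [LHS]mxE [RHS]mxE [X in _ = X + _]mxE hessian_cub !mxE big_ord1 !mxE.
have Dd := is_diff_dcub (a x) y (e j) g_sym.
have D := is_diff_mul (is_diff_sqr_cbrt'_cub Ty0) Dd.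
rewrite {1}/dy (@partial_near _ _ _
  (fun y => sqr_cbrt' (T x y) * dcub (g x) (a x) y (e j))).
  by rewrite (partial_diff i D) /=; ring.
by apply: filterS (near_cub_neq0 Ty0) => z Tz0; rewrite dy_sqr.
Qed.

Lemma mul_hessian_cub u y :
  u *m hessian_y T x y = \row_h hcub (g x) (a x) y (e h) u.
Proof.
apply/rowP => h; rewrite !mxE [in RHS](row_sum_delta u) hcub_sum.
by apply: eq_bigr => i _; rewrite hessian_cub.
Qed.

(* Since F^2 = r(T) with 3 T r'' = - r', the rank-one corrections to [T_yy] and to
   the right-hand side cancel, and the spray is governed by T alone. *)
Lemma spray_cub u y i : regular_dom T x y ->
  u *m hessian_y T x y = \row_h euler h y ->
  spray (fun z y => cube_root (cub (g z) (a z) y)) i x y = 2^-1 * u 0 i.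
Proof.
move=> [Ty0 uH] uE; set H := hessian_y T x y in uH uE.
pose t : V := \row_i dcub (g x) (a x) y (e i).
pose p := sqr_cbrt' (T x y).
have p0 : p != 0 by exact: sqr_cbrt'_neq0.
have HT : H^T = H.
  by apply/matrixP => j k; rewrite mxE !hessian_cub hcubC.
have yH : y *m H = 2 *: t.
  by rewrite mul_hessian_cub; apply/rowP => j; rewrite !mxE hcub_self.
have zt z : (z *m t^T) 0 0 = dcub (g x) (a x) y z.
  rewrite mxE [in RHS](row_sum_delta z) dcub_sum.
  by apply: eq_bigr => j _; rewrite !mxE.
have yt : (y *m t^T) 0 0 = 3 * T x y by rewrite zt dcub_self.
set M := hessian_y L x y.
have ME : M = p *: H - (p / (3 * T x y)) *: (t^T *m t) by apply: hessian_sqr.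
have uM : M \in unitmx by rewrite ME; exact: unitmx_rank1 yH yt.
have MT : M^T = M.
  by rewrite ME linearB /= !linearZ /= HT trmx_mul trmxK.
(* Contract the equation for [u] with [y]. Euler's relation turns the left side into $2T_y(u)$ and
   the right side into $(3-1)\sum_k T_{x^k}y^k$. *)
have ut : dcub (g x) (a x) y u = \sum_k cub_x k y * y 0 k.
  have : (u *m H *m y^T) 0 0 = 2 * dcub (g x) (a x) y u.
    rewrite -mulmxA -[H *m _]trmxK trmx_mul trmxK HT yH linearZ /= -scalemxAr.
    by rewrite mxE zt.
  rewrite uE mxE; under eq_bigr do rewrite !mxE.
  have -> : \sum_i euler i y * y 0 i = 2 * \sum_k cub_x k y * y 0 k.
    rewrite /euler_cub; under eq_bigr do rewrite mulrBl.
    rewrite sumrB; under eq_bigr do rewrite mulr_suml.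
    rewrite exchange_big /= mulr_sumr -sumrB; apply: eq_bigr => k _.
    under eq_bigr do rewrite mulrAC.
    rewrite -mulr_suml; have -> : \sum_i dcub_x k y (e i) * y 0 i = 3 * cub_x k y.
      rewrite /var_dcub; under eq_bigr do rewrite mulrC mulrDr.
      by rewrite big_split /= -!dcub_sum -row_sum_delta !dcub_self /var_cub; ring.
    ring.
  by move/mulfI => ->.
(* The same [u] solves the linear system of $F^2$: by [ut] the rank-one terms on the two sides
   agree. *)
have EL h : \sum_k dy h (dx k L) x y * y 0 k - dx h L x y = (u *m M) 0 h.
  rewrite ME mulmxBr -!scalemxAr uE mulmxA [u *m t^T]mx11_scalar mul_scalar_mx zt ut.
  rewrite !mxE dx_sqr // /euler_cub -/p mulrBr mulr_sumr.
  under eq_bigr do rewrite dy_dx_sqr // -/p mulrBl.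
  rewrite sumrB addrAC; congr (_ - _ - _).
    by apply: eq_bigr => k _; rewrite mulrA.
  rewrite mulr_suml mulr_sumr; apply: eq_bigr => k _; ring.
rewrite /spray /finsler_metric -/M; congr (_ * _).
under eq_bigr do rewrite EL.
(* The metric is half of [M], so its inverse is twice that of [M]; this cancels one of the two
   factors 1/2 in [spray]. *)
rewrite invmxZ ?unitmxZ ?unitfE ?invr_eq0 ?pnatr_eq0 // invrK.
have -> : \sum_h (2 *: invmx M) i h * (u *m M) 0 h = 2 * (invmx M *m (u *m M)^T) i 0.
  rewrite [in RHS]mxE mulr_sumr; apply: eq_bigr => h _.
  by rewrite mulrA; congr (_ * _); [rewrite [LHS]mxE | rewrite [RHS]mxE].
by rewrite trmx_mul MT mulKmx // mxE mulKf ?pnatr_eq0.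
Qed.

End LocalSpray.

(** * Covariant derivatives and the Levi-Civita connection *)

Section CovariantDerivatives.
Context {R : realType} {n : nat}.
Implicit Types (g dg S : 'M[R]_n) (a da y z v w : 'rV[R]_n).
Local Notation e i := (delta_mx 0 i : 'rV[R]_n).

(* [S i j k] stands for the connection coefficient with lower indices i, j and
   upper index k; [cov_mx] and [cov_rV] take the matrix [S i] of one direction i. *)
Definition cov_mx S g dg : 'M[R]_n := dg - S *m g - g *m S^T.
Definition cov_rV S a da : 'rV[R]_n := da - a *m S^T.

Lemma qf_cov S g dg y z :
  qf (cov_mx S g dg) y z = qf dg y z - qf g (y *m S) z - qf g y (z *m S).
Proof. by rewrite /cov_mx !qfB_mx !qfE trmx_mul !mulmxA. Qed.

Lemma lf_cov S a da y : lf (cov_rV S a da) y = lf da y - lf a (y *m S).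
Proof. by rewrite /cov_rV lfB_form !lfE trmx_mul mulmxA. Qed.

Lemma cov_mxT S g dg : g^T = g -> dg^T = dg -> (cov_mx S g dg)^T = cov_mx S g dg.
Proof.
by move=> gT dgT; rewrite /cov_mx !linearB /= !trmx_mul trmxK gT dgT addrAC.
Qed.

Lemma var_cub_cov S g a dg da y : g^T = g ->
  var_cub g a (cov_mx S g dg) (cov_rV S a da) y =
  var_cub g a dg da y - dcub g a y (y *m S).
Proof.
move=> gT; rewrite /var_cub /cub /dcub qf_cov lf_cov (qfC (y *m S) y gT); ring.
Qed.

Lemma var_dcub_cov S g a dg da y v : g^T = g ->
  var_dcub g a (cov_mx S g dg) (cov_rV S a da) y v =
  var_dcub g a dg da y v - hcub g a y v (y *m S) - dcub g a y (v *m S).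
Proof.
move=> gT; rewrite /var_dcub /dcub /hcub !qf_cov !lf_cov.
rewrite (qfC (y *m S) y gT) (qfC (y *m S) v gT); ring.
Qed.

(** Passing to covariant derivatives creates two corrections with first fibre derivatives. Symmetry
    of [S] makes them cancel, and only the Hessian term remains. *)
Lemma euler_cub_cov (S dg : 'I_n -> 'M[R]_n) (da : 'I_n -> 'rV[R]_n) g a h y :
  g^T = g -> (forall i j k, S i j k = S j i k) ->
  euler_cub g a dg da h y - hcub g a y (e h) (\sum_k y 0 k *: (y *m S k)) =
  euler_cub g a (fun k => cov_mx (S k) g (dg k)) (fun k => cov_rV (S k) a (da k)) h y.
Proof.
move=> gT SC; rewrite /euler_cub var_cub_cov // hcub_sum.
under [X in _ = X - _]eq_bigr do rewrite var_dcub_cov // 2!mulrBl.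
rewrite !sumrB.
have -> : \sum_k dcub g a y (e h *m S k) * y 0 k = dcub g a y (y *m S h).
  have -> : y *m S h = \sum_k y 0 k *: (e h *m S k).
    apply/rowP => i; rewrite mxE summxE; apply: eq_bigr => k _.
    by rewrite -rowE !mxE SC.
  by rewrite dcub_sum; apply: eq_bigr => k _; rewrite mulrC.
rewrite opprB addrA subrK addrAC; congr (_ - _ - _).
by apply: eq_bigr => k _; rewrite mulrC.
Qed.

(** Let $R_k$ be the variation in direction $k$, a cubic in $y$. The hypothesis reads $\sum_k
    y^k\,\partial R_k/\partial y^h=R_h$. *)
Lemma euler_cub_eq0 g a (dg : 'I_n -> 'M[R]_n) (da : 'I_n -> 'rV[R]_n) :
  g^T = g -> (forall k, (dg k)^T = dg k) ->
  (forall h y, euler_cub g a dg da h y = 0) ->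
  forall h y, var_cub g a (dg h) (da h) y = 0.
Proof.
move=> gT dgT E0 h y.
pose P z := \sum_k z 0 k * var_cub g a (dg k) (da k) z.
have selfE k z : \sum_i var_dcub g a (dg k) (da k) z (e i) * z 0 i =
    3 * var_cub g a (dg k) (da k) z.
  rewrite /var_dcub; under eq_bigr do rewrite mulrC mulrDr.
  by rewrite big_split /= -!dcub_sum -row_sum_delta !dcub_self /var_cub; ring.
(* Contracting with $y^h$ gives $3P=P$, because each $R_k$ has degree 3. *)
have P0 z : P z = 0.
  have : \sum_h z 0 h * euler_cub g a dg da h z = 0.
    by rewrite big1 // => i _; rewrite E0 mulr0.
  rewrite /euler_cub; under eq_bigr do rewrite mulrBr mulr_sumr.
  rewrite sumrB exchange_big /=.
  have -> : \sum_j \sum_i z 0 i * (var_dcub g a (dg j) (da j) z (e i) * z 0 j) = 3 * P z.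
    rewrite mulr_sumr; apply: eq_bigr => k _.
    rewrite mulrCA -selfE mulr_sumr; apply: eq_bigr => i _; ring.
  rewrite -/(P z); lra.
have DP := is_diff_sum (index_enum 'I_n) (fun k => is_diff_mul (is_diff_coord k y)
  (is_diff_var_cub a (da k) y gT (dgT k))).
(* Differentiating $P=0$ gives $R_h+\sum_k y^k\,\partial R_k/\partial y^h=0$, that is, $2R_h=0$. *)
have := partial_diff h DP; rewrite (_ : (fun _ => _) = fun=> 0); last first.
  by apply/funext => z; exact: P0.
rewrite (partial_diff h (is_diff_const 0 y)) big_split /=.
under [X in _ + X]eq_bigr do rewrite mulrC.
rewrite sum_delta_rV; move: (E0 h y); rewrite /euler_cub; under eq_bigr do rewrite mulrC.
lra.
Qed.

(** Here [v] is the metric dual of [a], and [qf dg v v = 2 * lf da v] is the derivative of the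
    condition $|a|=1$. The form [da] is killed first, on the kernel of [a] and at [v]; then [dg]
    vanishes off that kernel, hence everywhere. *)
Lemma var_cub_eq0 g a dg da v : dg^T = dg ->
  (forall y, y != 0 -> 0 < qf g y y) -> (forall y, qf g v y = lf a y) ->
  lf a v = 1 -> qf dg v v = 2 * lf da v ->
  (forall y, var_cub g a dg da y = 0) -> da = 0 /\ dg = 0.
Proof.
move=> dgT gpos vE av nv R0.
have R0' y : qf dg y y * lf a y + qf g y y * lf da y = 0 by exact: R0.
have ker y : lf a y = 0 -> lf da y = 0.
  move=> ay; have [->|y0] := eqVneq y 0; first by rewrite lfE trmx0 mulmx0 mxE.
  have := R0' y; rewrite ay mulr0 add0r => /eqP; rewrite mulf_eq0.
  by rewrite gt_eqF ?gpos //= => /eqP.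
(* At [v] the identity reads [2 * lf da v + lf da v = 0]. *)
have dav : lf da v = 0 by have := R0' v; rewrite nv vE av; lra.
have da0 y : lf da y = 0.
  have := ker (y + (- lf a y) *: v); rewrite !lfD !lfZ av dav mulr1 mulr0 addr0.
  by apply; rewrite subrr.
have dg0 y : lf a y != 0 -> qf dg y y = 0.
  move=> ay; have := R0' y; rewrite da0 mulr0 addr0 => /eqP.
  by rewrite mulf_eq0 (negPf ay) orbF => /eqP.
(* For [y] in the kernel of [a], the form [a] is nonzero at [y + v], [y - v] and [v]; the
   parallelogram identity then gives the value at [y]. *)
have {}dg0 y : qf dg y y = 0.
  have [ay|/dg0 //] := eqVneq (lf a y) 0.
  have p : qf dg (y + v) (y + v) = 0 by rewrite dg0 // lfD ay av add0r oner_eq0.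
  have m : qf dg (y + (-1) *: v) (y + (-1) *: v) = 0.
    by rewrite dg0 // lfD lfZ ay av add0r mulr1 oppr_eq0 oner_eq0.
  have vv : qf dg v v = 0 by rewrite dg0 // av oner_eq0.
  move: p m; rewrite !qfDl !qfDr !qfZl !qfZr vv; lra.
split; first by apply/rowP => i; rewrite -lf_delta da0 mxE.
apply/matrixP => i j; rewrite [RHS]mxE -qf_delta.
have := dg0 (e i + e j); rewrite !qfDl !qfDr !dg0 (qfC (e j) (e i) dgT); lra.
Qed.

Definition levi_civita g (dg : 'I_n -> 'M[R]_n) (i : 'I_n) : 'M[R]_n :=
  \matrix_(j, k) (2^-1 * \sum_l invmx g k l * (dg i j l + dg j i l - dg l i j)).

Lemma cov_mxE S g dg i j : g^T = g ->
  cov_mx S g dg i j = dg i j - (S *m g) i j - (S *m g) j i.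
Proof.
move=> gT; rewrite /cov_mx; have -> : g *m S^T = (S *m g)^T by rewrite trmx_mul gT.
by move: (S *m g) => P; rewrite !mxE.
Qed.

Lemma levi_civitaC g (dg : 'I_n -> 'M[R]_n) i j k : (forall k, (dg k)^T = dg k) ->
  levi_civita g dg i j k = levi_civita g dg j i k.
Proof.
move=> dgT; rewrite !mxE; congr (_ * _); apply: eq_bigr => l _.
have -> : dg l i j = dg l j i by rewrite -{1}(dgT l) mxE.
by rewrite (addrC (dg i j l)).
Qed.

(** Lowering the upper index yields the Koszul expression, whose symmetrization in its last two
    indices is [dg i]. *)
Lemma cov_levi_civita g (dg : 'I_n -> 'M[R]_n) i :
  g \in unitmx -> g^T = g -> (forall k, (dg k)^T = dg k) ->
  cov_mx (levi_civita g dg i) g (dg i) = 0.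
Proof.
move=> ug gT dgT.
have P j l : (levi_civita g dg i *m g) j l = 2^-1 * (dg i j l + dg j i l - dg l i j).
  pose c : 'cV_n := \col_l (dg i j l + dg j i l - dg l i j).
  transitivity (2^-1 * (g *m (invmx g *m c)) l 0); last by rewrite mulKVmx // mxE.
  rewrite !mxE mulr_sumr; apply: eq_bigr => k _; rewrite !mxE -{2}gT mxE.
  rewrite mulrC mulrCA; congr (_ * (_ * _)).
  by apply: eq_bigr => m _; rewrite mxE.
apply/matrixP => j l; rewrite cov_mxE // !P [RHS]mxE.
have -> : dg i l j = dg i j l by rewrite -{1}(dgT i) mxE.
lra.
Qed.

(** The lowered coefficients are symmetric in their first two indices, and [dg] is their
    symmetrization in the last two; the Koszul combination of [dg] recovers them. *)
Lemma levi_civita_unique g (S dg : 'I_n -> 'M[R]_n) : g \in unitmx -> g^T = g ->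
  (forall i j k, S i j k = S j i k) ->
  (forall i, cov_mx (S i) g (dg i) = 0) -> forall i, S i = levi_civita g dg i.
Proof.
move=> ug gT SC S0 i.
have PC p q r : (S p *m g) q r = (S q *m g) p r.
  by rewrite !mxE; apply: eq_bigr => m _; rewrite SC.
have dgE p q r : dg p q r = (S p *m g) q r + (S p *m g) r q.
  have /matrixP/(_ q r) := S0 p; rewrite cov_mxE // [RHS]mxE; lra.
apply/matrixP => j k; rewrite [RHS]mxE.
transitivity ((S i *m g *m invmx g) j k); first by rewrite mulmxK.
rewrite mxE mulr_sumr; apply: eq_bigr => l _; rewrite !dgE.
have -> : invmx g l k = invmx g k l by rewrite -[g in LHS]gT -trmx_inv mxE.
rewrite (PC j i l) (PC i l j) (PC j l i); set a := (S i *m g) j l.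
lra.
Qed.

End CovariantDerivatives.

(** * Polynomial functions and Euler's relation *)

Section PolynomialFunctions.
Context {R : realType} {n : nat}.
Local Notation V := 'rV[R]_n.
Implicit Types (f d : V -> R) (y z v w : V).

(** Polynomials as functions, given by generators: differentiability and restriction to lines follow
    by induction. *)
Inductive polyfun : (V -> R) -> Prop :=
| polyfun_const c : polyfun (fun=> c)
| polyfun_coord i : polyfun (fun y => y 0 i)
| polyfun_add f d : polyfun f -> polyfun d -> polyfun (fun y => f y + d y)
| polyfun_mul f d : polyfun f -> polyfun d -> polyfun (fun y => f y * d y).

Lemma polyfun_ext f d : f =1 d -> polyfun f -> polyfun d.
Proof. by move=> /funext ->. Qed.

Lemma polyfun_opp f : polyfun f -> polyfun (fun y => - f y).
Proof.
move=> pf; apply: polyfun_ext (polyfun_mul (polyfun_const (-1)) pf) => y.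
exact: mulN1r.
Qed.

Lemma polyfun_sum (I : Type) (r : seq I) (F : I -> V -> R) :
  (forall i, polyfun (F i)) -> polyfun (fun y => \sum_(i <- r) F i y).
Proof.
move=> pF; elim: r => [|i r IH].
  by apply: polyfun_ext (polyfun_const 0) => y; rewrite big_nil.
by apply: polyfun_ext (polyfun_add (pF i) IH) => y; rewrite big_cons.
Qed.

Lemma polyfun_prod (I : Type) (r : seq I) (F : I -> V -> R) :
  (forall i, polyfun (F i)) -> polyfun (fun y => \prod_(i <- r) F i y).
Proof.
move=> pF; elim: r => [|i r IH].
  by apply: polyfun_ext (polyfun_const 1) => y; rewrite big_nil.
by apply: polyfun_ext (polyfun_mul (pF i) IH) => y; rewrite big_cons.
Qed.

Lemma polyfun_det m (A : V -> 'M[R]_m) :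
  (forall i j, polyfun (fun y => A y i j)) -> polyfun (fun y => \det (A y)).
Proof.
move=> pA; apply: polyfun_sum => s; apply: polyfun_mul; first exact: polyfun_const.
by apply: polyfun_prod.
Qed.

Lemma polyfun_diffn k U f : open U -> polyfun f -> diffn k U f.
Proof.
move=> oU; elim=> [c|i|f1 f2 _ D1 _ D2|f1 f2 _ D1 _ D2].
- exact: diffn_const.
- exact: diffn_coord.
- exact: diffn_add.
- exact: diffn_mul.
Qed.

Lemma polyfun_line f y z : polyfun f ->
  exists p : {poly R}, forall t, f (y + t *: z) = p.[t].
Proof.
elim=> [c|i|f1 f2 _ [p pE] _ [q qE]|f1 f2 _ [p pE] _ [q qE]].
- by exists c%:P => t; rewrite hornerC.
- by exists ((y 0 i)%:P + (z 0 i)%:P * 'X) => t; rewrite !hornerE !mxE mulrC.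
- by exists (p + q) => t; rewrite hornerD pE qE.
- by exists (p * q) => t; rewrite hornerM pE qE.
Qed.

(** In characteristic 0 the naturals below [size p] are distinct roots, more than the degree
    allows. *)
Lemma poly_eq0_horner (p : {poly R}) : (forall t, p.[t] = 0) -> p = 0.
Proof.
move=> p0; apply: (@roots_geq_poly_eq0 _ _ [seq i%:R | i <- iota 0 (size p)]).
- by apply/allP => t _; apply/eqP/p0.
- by rewrite map_inj_uniq ?iota_uniq // => i j /eqP; rewrite eqr_nat => /eqP.
- by rewrite size_map size_iota.
Qed.

(** On the line from [y0] to [y] the product of [f] and [d] is the zero polynomial in [t]. Its
    factor from [d] is nonzero at [t = 0], so the factor from [f] is zero; take [t = 1]. *)
Lemma polyfun_eq0 f d y0 : polyfun f -> polyfun d -> d y0 != 0 ->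
  (forall y, d y != 0 -> f y = 0) -> forall y, f y = 0.
Proof.
move=> pf pd dy0 f0 y.
have [p pE] := polyfun_line y0 (y - y0) pf.
have [q qE] := polyfun_line y0 (y - y0) pd.
have : p * q = 0.
  apply: poly_eq0_horner => t; rewrite hornerM -pE -qE.
  by have [->|/f0 ->] := eqVneq (d (y0 + t *: (y - y0))) 0; rewrite (mulr0, mul0r).
have q0 : q != 0.
  by apply: contra_neq dy0 => q0; rewrite -[y0]addr0 -(scale0r (y - y0)) qE q0 horner0.
move/eqP; rewrite mulf_eq0 (negPf q0) orbF => /eqP p0.
by rewrite -[y](subrK y0) addrC -(scale1r (y - y0)) pE p0 horner0.
Qed.

Lemma polyfun_lf a : polyfun (lf a).
Proof.
by apply: polyfun_sum => i; apply: polyfun_mul; [exact: polyfun_const|exact: polyfun_coord].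
Qed.

Lemma polyfun_qf g v : polyfun (qf g v).
Proof.
apply: polyfun_sum => i; apply: polyfun_sum => j.
by apply: polyfun_mul; [exact: polyfun_const|exact: polyfun_coord].
Qed.

Lemma polyfun_quad g : polyfun (fun y => qf g y y).
Proof.
apply: polyfun_sum => i; apply: polyfun_sum => j.
apply: polyfun_mul; last exact: polyfun_coord.
by apply: polyfun_mul; [exact: polyfun_const|exact: polyfun_coord].
Qed.

Lemma polyfun_cub g a : polyfun (cub g a).
Proof. by apply: polyfun_mul; [exact: polyfun_quad|exact: polyfun_lf]. Qed.

Lemma polyfun_dcub g a v : g^T = g -> polyfun (fun y => dcub g a y v).
Proof.
move=> gT; apply: polyfun_add; last first.
  by apply: polyfun_mul; [exact: polyfun_quad|exact: polyfun_const].
apply: polyfun_mul; last exact: polyfun_lf.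
apply: polyfun_mul; first exact: polyfun_const.
by apply: polyfun_ext (polyfun_qf g v) => y; rewrite qfC.
Qed.

Lemma polyfun_hcub g a v w : g^T = g -> polyfun (fun y => hcub g a y v w).
Proof.
move=> gT; apply: polyfun_ext (polyfun_mul (polyfun_const 2) (polyfun_add (polyfun_add
  (polyfun_mul (polyfun_const (qf g v w)) (polyfun_lf a))
  (polyfun_mul (polyfun_qf g v) (polyfun_const (lf a w))))
  (polyfun_mul (polyfun_qf g w) (polyfun_const (lf a v))))) => y.
by rewrite /hcub (qfC y v gT) (qfC y w gT).
Qed.

Lemma polyfun_euler_cub g a (dg : 'I_n -> 'M[R]_n) (da : 'I_n -> V) h :
  g^T = g -> (forall k, (dg k)^T = dg k) -> polyfun (euler_cub g a dg da h).
Proof.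
move=> gT dgT; apply: polyfun_add; last first.
  by apply: polyfun_opp; apply: polyfun_add; exact: polyfun_cub.
apply: polyfun_sum => k; apply: polyfun_mul; last exact: polyfun_coord.
by apply: polyfun_add; exact: polyfun_dcub.
Qed.

Lemma cubZ g a t y : cub g a (t *: y) = t ^+ 3 * cub g a y.
Proof. rewrite /cub qfZl qfZr lfZ; ring. Qed.

Lemma dcubZ g a t y v : dcub g a (t *: y) v = t ^+ 2 * dcub g a y v.
Proof. rewrite /dcub qfZl qfZl qfZr lfZ; ring. Qed.

Lemma hcubZ g a t y v w : hcub g a (t *: y) v w = t * hcub g a y v w.
Proof. rewrite /hcub !qfZl lfZ; ring. Qed.

Lemma euler_cubZ g a (dg : 'I_n -> 'M[R]_n) (da : 'I_n -> V) h t y :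
  euler_cub g a dg da h (t *: y) = t ^+ 3 * euler_cub g a dg da h y.
Proof.
rewrite /euler_cub mulrBr mulr_sumr; congr (_ - _).
  by apply: eq_bigr => k _; rewrite /var_dcub !dcubZ mxE; ring.
by rewrite /var_cub !cubZ; ring.
Qed.

End PolynomialFunctions.

Section EulerRelation.
Context {R : realType} {n : nat}.
Local Notation V := 'rV[R]_n.
Variables (U : set V) (f : V -> R).
Hypotheses (oU : open U) (f_diff : diffn 1 U f).
Hypothesis f_hom : forall y t, U y -> t != 0 -> f (t *: y) = t ^+ 2 * f y.

(** The difference quotient at [y] along [y] is $((h+1)^2-1)f(y)/h=(h+2)f(y)$, with limit
    $2f(y)$. *)
Lemma euler_relation y : U y -> \sum_k y 0 k * partial k f y = 2 * f y.
Proof.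
move=> Uy; have fy := diffn_differentiable f_diff Uy.
have := @diff_val _ _ _ _ _ _ _ (is_diff_differentiable fy) => /(congr1 (@^~ y)) <-.
rewrite -deriveE //; apply: cvg_lim => //.
have N : nbhs (0 : R) [set h | h != -1].
  by apply: open_nbhs_nbhs; split; [exact: open_neq|rewrite /= eq_sym oppr_eq0 oner_eq0].
(* Homogeneity is assumed for nonzero factors only, so [h = -1] must be avoided. *)
have near1 : \forall h \near (0 : R)^', h != 0 /\ h + 1 != 0.
  near=> h; split; near: h; first exact: nbhs_dnbhs_neq.
  by apply: nbhs_dnbhs; apply: filterS N => h; rewrite /= addr_eq0.
apply: (@cvg_trans _ ((fun h : R => (h + 2) * f y) @ (0 : R)^')).
  apply: near_eq_cvg; apply: filterS near1 => h [h0 h1] /=.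
  have -> : h *: y + y = (h + 1) *: y by rewrite scalerDl scale1r.
  by rewrite f_hom // /GRing.scale /=; field.
have C : (fun h : R => (h + 2) * f y) @ (0 : R) --> (0 + 2) * f y.
  by apply: cvgM; [apply: cvgD; [exact: cvg_id|exact: cvg_cst]|exact: cvg_cst].
rewrite add0r in C; apply: cvg_trans C; apply: cvg_app; exact: nbhs_dnbhs.
Unshelve. all: by end_near. Qed.

(** Differentiating Euler's relation gives $\sum_k y^k\,\partial_j\partial_kf=\partial_jf$; contract
    with $y^j$. Thus [f] is recovered from its second derivatives. *)
Lemma euler_relation2 y : U y ->
  2 * f y = \sum_j \sum_k y 0 j * y 0 k * partial j (partial k f) y.
Proof.
move=> Uy; have fy := diffn_differentiable f_diff Uy.
rewrite -euler_relation //; apply: eq_bigr => j _.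
have D := is_diff_sum (index_enum 'I_n) (fun k => is_diff_mul (is_diff_coord k y)
  (is_diff_differentiable (diffn_differentiable (diffn_partial k f_diff) Uy))).
have := partial_diff j D.
rewrite (partial_near _ (near_open oU Uy euler_relation)).
rewrite (partial_diff j (is_diff_scale 2 (is_diff_differentiable fy))).
under [in RHS]eq_bigr do rewrite sum_delta_rV mulrC [X in _ + X]mulrC.
rewrite big_split /= !sum_delta_rV.
under [X in _ = _ -> _ = X]eq_bigr do rewrite -mulrA.
rewrite -mulr_sumr => E; congr (_ * _).
under eq_bigr do rewrite mulrC.
lra.
Qed.

End EulerRelation.

(** * The equivalence in one chart *)

Section LocalTheorem.
Context {R : realType} {n : nat}.
Local Notation V := 'rV[R]_n.
Variables (U : set V) (g : V -> 'M[R]_n) (a : V -> V).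
Hypothesis oU : open U.
Hypothesis g_smooth : forall i j, smooth_on U (fun x => g x i j).
Hypothesis a_smooth : forall i, smooth_on U (fun x => a x 0 i).
Hypothesis g_sym : forall x, U x -> (g x)^T = g x.
Hypothesis g_pos : forall x, U x -> forall y : V, y != 0 -> 0 < (y *m g x *m y^T) 0 0.
Hypothesis a_unit : forall x, U x ->
  \sum_i \sum_j invmx (g x) i j * a x 0 i * a x 0 j = 1.

Local Notation e i := (delta_mx 0 i : V).
Local Notation T := (fun x y => cub (g x) (a x) y).
Local Notation F := (fun x y => cube_root (cub (g x) (a x) y)).
Local Notation dg x := (partial_mx g x).
Local Notation da x := (partial_rV a x).
Local Notation LC x := (levi_civita (g x) (dg x)).
Local Notation euler x := (euler_cub (g x) (a x) (dg x) (da x)).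

Lemma qf_gt0 x y : U x -> y != 0 -> 0 < qf (g x) y y.
Proof. by move=> Ux y0; rewrite qfE g_pos. Qed.

Lemma g_unit x : U x -> g x \in unitmx.
Proof.
move=> Ux; apply: unitmx_inj => v vg; have [//|/(g_pos Ux)] := eqVneq v 0.
by rewrite vg mul0mx mxE ltxx.
Qed.

Lemma g_diff x i j : U x -> differentiable (fun z => g z i j) x.
Proof. by move=> Ux; exact: (g_smooth i j [::] Ux). Qed.

Lemma a_diff x i : U x -> differentiable (fun z => a z 0 i) x.
Proof. by move=> Ux; exact: (a_smooth i [::] Ux). Qed.

Lemma dg_sym x k : U x -> (dg x k)^T = dg x k.
Proof.
move=> Ux; apply/matrixP => i j; rewrite !mxE; apply: partial_near.
by apply: (near_open oU Ux) => z Uz; rewrite -{1}(g_sym Uz) mxE.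
Qed.

Definition sharp x : V := a x *m invmx (g x).

Lemma sharpE x y : U x -> qf (g x) (sharp x) y = lf (a x) y.
Proof. by move=> Ux; rewrite qfE /sharp mulmxKV ?g_unit // lfE. Qed.

Lemma lf_sharp x : U x -> lf (a x) (sharp x) = 1.
Proof.
move=> Ux; rewrite -(a_unit Ux) exchange_big /=; apply: eq_bigr => i _.
rewrite /sharp mxE mulr_sumr; apply: eq_bigr => j _; ring.
Qed.

(* The derivative of [|a|^2 = 1] without differentiating the inverse metric: with
   v = sharp x, differentiate both a(v) = 1 and v *m g = a. *)
Lemma qf_dsharp x k : U x ->
  qf (dg x k) (sharp x) (sharp x) = 2 * lf (da x k) (sharp x).
Proof.
move=> Ux.
have sharp_diff i : differentiable (fun z => sharp z 0 i) x.
  apply: (@diffn_differentiable _ _ 0 U) => //.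
  apply: (@diffn_ext _ _ _ oU _ (fun z => \sum_j a z 0 j * invmx (g z) j i)).
    by move=> z _; rewrite [RHS]mxE.
  apply: (diffn_sum oU) => j; apply: (diffn_mul oU); first exact: smooth_on_diffn.
  apply: (diffn_invmx oU) => [p q|z]; [exact: smooth_on_diffn|exact: g_unit].
have Da i := is_diff_differentiable (a_diff i Ux).
have Dg i j := is_diff_differentiable (g_diff i j Ux).
have Ds i := is_diff_differentiable (sharp_diff i).
pose ds : V := \row_i partial k (fun z => sharp z 0 i) x.
have E1 : lf (a x) ds + lf (da x k) (sharp x) = 0.
  have := partial_diff k (is_diff_sum (index_enum 'I_n) (fun i => is_diff_mul (Da i) (Ds i))).
  rewrite (partial_near _ (near_open oU Ux lf_sharp)).
  rewrite (partial_diff k (is_diff_const 1 x)) big_split /= => ->.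
  congr (_ + _); apply: eq_bigr => i _;
    rewrite -?(partial_diff k (Ds i)) -?(partial_diff k (Da i)) mxE //.
  by rewrite mulrC.
have E2 j : \sum_i (sharp x 0 i * dg x k i j + g x i j * ds 0 i) = da x k 0 j.
  have := partial_diff k (is_diff_sum (index_enum 'I_n) (fun i => is_diff_mul (Ds i) (Dg i j))).
  have sg z : U z -> \sum_i sharp z 0 i * g z i j = a z 0 j.
    by move=> Uz; have := mulmxKV (g_unit Uz) (a z); move/rowP/(_ j); rewrite mxE.
  rewrite (partial_near _ (near_open oU Ux sg)) mxE => ->.
  apply: eq_bigr => i _.
  by rewrite -(partial_diff k (Ds i)) -(partial_diff k (Dg i j)) !mxE.
(* This is [E2] contracted with [sharp x]; subtracting [E1] eliminates [ds]. *)
have E3 : qf (dg x k) (sharp x) (sharp x) + lf (a x) ds = lf (da x k) (sharp x).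
  rewrite -(sharpE ds Ux) (qfC _ _ (g_sym Ux)) /qf exchange_big /=.
  rewrite [X in _ + X]exchange_big -big_split /=; apply: eq_bigr => j _.
  rewrite -E2 mulr_suml -big_split /=; apply: eq_bigr => i _; ring.
lra.
Qed.

(* At the metric dual of [a] the Hessian is 2 (g + 2 a^T a), which is positive definite. *)
Lemma regular_sharp x : U x -> regular_dom T x (sharp x).
Proof.
move=> Ux; split; first by rewrite /cub sharpE // lf_sharp // mulr1 oner_eq0.
apply: unitmx_inj => w; rewrite mul_hessian_cub ?g_sym // => /rowP w0.
have [//|/(qf_gt0 Ux) wpos] := eqVneq w 0; exfalso.
have : hcub (g x) (a x) (sharp x) w w = 0.
  rewrite [X in hcub _ _ _ _ X](row_sum_delta w) hcub_sum big1 // => h _.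
  by have := w0 h; rewrite !mxE hcubC ?g_sym // => ->; rewrite mulr0.
rewrite /hcub sharpE // lf_sharp // mulr1.
by have := sqr_ge0 (lf (a x) w); rewrite expr2; lra.
Qed.

(** * The two implications at a fixed base point *)

Section AtPoint.
Variables (x : V) (Ux : U x).

(** The regular domain is where two polynomials in [y], the cubic and its Hessian determinant, are
    both nonzero. *)
Lemma open_regular : open [set y | regular_dom T x y].
Proof.
have openN f : polyfun f -> open [set y | f y != 0].
  move=> pf; apply: (@open_comp _ _ f [set t | t != 0]); last exact: open_neq.
  move=> y _; apply: differentiable_continuous.
  by apply: (diffn_differentiable (polyfun_diffn 0 openT pf)).
have -> : [set y | regular_dom T x y] = [set y | cub (g x) (a x) y != 0] `&`
    [set y | \det (hessian_y T x y) != 0].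
  by apply/seteqP; split=> y []; rewrite /regular_dom /= unitmxE unitfE.
apply: openI; first exact/openN/polyfun_cub.
apply/openN/polyfun_det => i j.
by apply: polyfun_ext (polyfun_hcub _ _ _ (g_sym Ux)) => y; rewrite hessian_cub ?g_sym.
Qed.

(** This function agrees with the spray on the regular domain. It is rational in [y], and its
    denominator, the Hessian determinant, does not vanish there. *)
Lemma spray_diffn i k : diffn k [set y | regular_dom T x y]
  (fun y => 2^-1 * ((\row_h euler x h y) *m invmx (hessian_y T x y)) 0 i).
Proof.
have oD := open_regular.
apply: (diffn_mul oD); first exact: diffn_const.
apply: (@diffn_ext _ _ _ oD _
  (fun y => \sum_h euler x h y * invmx (hessian_y T x y) h i)).
  by move=> y _; rewrite [RHS]mxE; apply: eq_bigr => h _; rewrite mxE.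
apply: (diffn_sum oD) => h; apply: (diffn_mul oD).
  by apply/polyfun_diffn/polyfun_euler_cub => // [|p]; [exact: g_sym|exact: dg_sym].
apply: (diffn_invmx oD) => [p q|y []//].
apply: (@diffn_ext _ _ _ oD _ (fun y => hcub (g x) (a x) y (e q) (e p))).
  by move=> y _; rewrite hessian_cub // g_sym.
by apply/polyfun_diffn/polyfun_hcub => //; exact: g_sym.
Qed.

Lemma spray_regular i y : regular_dom T x y -> spray F i x y =
  2^-1 * ((\row_h euler x h y) *m invmx (hessian_y T x y)) 0 i.
Proof.
move=> Dy; apply: spray_cub => //; [exact: (fun p q => g_diff p q Ux)
  |exact: (fun p => a_diff p Ux)|exact: g_sym|exact: (fun k => dg_sym k Ux)|].
by rewrite mulmxKV //; case: Dy.
Qed.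

Lemma hessian_cubZ t y : hessian_y T x (t *: y) = t *: hessian_y T x y.
Proof.
by apply/matrixP => i j; rewrite [RHS]mxE !hessian_cub ?g_sym // hcubZ.
Qed.

(** The vector $S^i_{jk}y^jy^k$, which is $2G^i$ for the spray of the connection [S]. *)
Definition geodesic_rV (S : 'I_n -> 'M[R]_n) (y : V) : V :=
  \sum_k y 0 k *: (y *m S k).

Lemma berwald_regular i j k y : regular_dom T x y ->
  berwald_connection F i j k x y = partial j (partial k (fun y =>
    2^-1 * ((\row_h euler x h y) *m invmx (hessian_y T x y)) 0 i)) y.
Proof.
move=> Dy; apply: partial_near; apply: (near_open open_regular Dy) => z Dz.
apply: partial_near; apply: (near_open open_regular Dz) => w Dw.
exact: spray_regular.
Qed.

Lemma polyfun_hcub_geodesic (S : 'I_n -> 'M[R]_n) h :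
  polyfun (fun y => hcub (g x) (a x) y (e h) (geodesic_rV S y)).
Proof.
pose f k j y := hcub (g x) (a x) y (e h) (row j (S k)).
apply: (@polyfun_ext _ _ (fun y => \sum_k y 0 k * \sum_j y 0 j * f k j y)).
  move=> y; rewrite /geodesic_rV hcub_sum; apply: eq_bigr => k _.
  by rewrite mulmx_sum_row hcub_sum.
apply: polyfun_sum => k; apply: polyfun_mul; first exact: polyfun_coord.
apply: polyfun_sum => j; apply: polyfun_mul; first exact: polyfun_coord.
exact/polyfun_hcub/g_sym.
Qed.

Lemma berwald_parallel (Gamma : 'I_n -> 'I_n -> 'I_n -> R) :
  (forall i j k y, regular_dom T x y ->
    berwald_connection F i j k x y = Gamma i j k) ->
  forall i, cov_rV (LC x i) (a x) (da x i) = 0.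
Proof.
move=> GammaE.
(* Symmetrizing by hand makes [S] torsion-free without commuting second derivatives, and leaves the
   quadratic form unchanged. *)
pose S k : 'M[R]_n := \matrix_(j, i) (2^-1 * (Gamma i j k + Gamma i k j)).
have SC p q r : S p q r = S q p r by rewrite !mxE addrC.
have gT := g_sym Ux; have dgT k := dg_sym k Ux; have ug := g_unit Ux.
pose G i y := 2^-1 * ((\row_h euler x h y) *m invmx (hessian_y T x y)) 0 i.
have G_hom i y t : regular_dom T x y -> t != 0 -> G i (t *: y) = t ^+ 2 * G i y.
  move=> Dy t0; rewrite /G hessian_cubZ invmxZ ?unitmxZ ?unitfE //; last by case: Dy.
  have -> : \row_h euler x h (t *: y) = t ^+ 3 *: \row_h euler x h y.
    by apply/rowP => h; rewrite !mxE euler_cubZ.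
  by rewrite -scalemxAr -scalemxAl !mxE; field.
(* The spray is 2-homogeneous with second derivatives independent of [y], so [euler_relation2] shows
   that it is quadratic. *)
have GE y : regular_dom T x y ->
    (\row_h euler x h y) *m invmx (hessian_y T x y) = geodesic_rV S y.
  move=> Dy; apply/rowP => i.
  have := euler_relation2 open_regular (spray_diffn i 1) (G_hom i) Dy.
  rewrite mulVKf ?pnatr_eq0 // => ->.
  rewrite /geodesic_rV summxE.
  under eq_bigr do under eq_bigr do rewrite -berwald_regular // GammaE //.
  under [RHS]eq_bigr do rewrite !mxE mulr_sumr.
  pose c p q := y 0 p * y 0 q * Gamma i p q.
  have -> : \sum_p \sum_q y 0 p * (y 0 q * S p q i) =
      2^-1 * (\sum_p \sum_q c p q + \sum_p \sum_q c q p).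
    rewrite -big_split mulr_sumr; apply: eq_bigr => p _.
    rewrite -big_split mulr_sumr; apply: eq_bigr => q _.
    by rewrite mxE /c /=; ring.
  have -> : \sum_p \sum_q c q p = \sum_p \sum_q c p q by rewrite exchange_big.
  by rewrite -[LHS]/(\sum_p \sum_q c p q); field.
have E0 h y : euler x h y - hcub (g x) (a x) y (e h) (geodesic_rV S y) = 0.
  (* This polynomial is nonzero exactly on the regular domain, which contains [sharp x]; hence the
     identity extends to all [y]. *)
  pose d y := T x y * \det (\matrix_(i, j) hcub (g x) (a x) y (e j) (e i)).
  have HE z : \matrix_(i, j) hcub (g x) (a x) z (e j) (e i) = hessian_y T x z.
    by apply/matrixP => i j; rewrite hessian_cub // mxE.
  pose f y := euler x h y - hcub (g x) (a x) y (e h) (geodesic_rV S y).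
  move: y; apply: (@polyfun_eq0 _ _ f d (sharp x)).
  - exact: (polyfun_add (polyfun_euler_cub (a x) (da x) h gT dgT)
      (polyfun_opp (polyfun_hcub_geodesic S h))).
  - apply: polyfun_mul; first exact: polyfun_cub.
    apply: polyfun_det => i j.
    by apply: polyfun_ext (polyfun_hcub _ (e j) (e i) gT) => z; rewrite mxE.
  - have [Ts Hs] := regular_sharp Ux.
    by rewrite /d HE mulf_neq0 // -unitfE -unitmxE.
  - move=> z; rewrite /d HE mulf_eq0 negb_or => /andP[Tz Hz].
    have uH : hessian_y T x z \in unitmx by rewrite unitmxE unitfE.
    have /(congr1 (mulmx^~ (hessian_y T x z))) := GE z (conj Tz uH).
    rewrite /= mulmxKV // mul_hessian_cub // => /rowP/(_ h).
    by rewrite /f !mxE => ->; rewrite subrr.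
have R0 := euler_cub_eq0 gT (fun k => cov_mxT (S k) gT (dgT k))
  (fun h y => etrans (esym (euler_cub_cov (dg x) (da x) (a x) h y gT SC)) (E0 h y)).
have cov0 k : cov_rV (S k) (a x) (da x k) = 0 /\ cov_mx (S k) (g x) (dg x k) = 0.
  apply: (@var_cub_eq0 _ _ (g x) (a x) _ _ (sharp x)) (R0 k).
  - exact: cov_mxT.
  - by move=> y; exact: qf_gt0.
  - by move=> y; exact: sharpE.
  - exact: lf_sharp.
  (* The derivative of $|a|=1$ survives the passage to covariant derivatives: both sides lose
     [2 * lf (a x) (sharp x *m S k)]. *)
  - by rewrite qf_cov lf_cov (qfC _ (sharp x) gT) !sharpE // qf_dsharp //; ring.
move=> i; rewrite -(levi_civita_unique ug gT SC (fun k => (cov0 k).2)).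
exact: (cov0 i).1.
Qed.

(** When the covariant derivatives of the metric and of the form vanish, the Levi-Civita geodesic
    vector solves the spray equation, so the spray is quadratic with the Christoffel symbols as
    second derivatives. *)
Lemma parallel_berwald i j k y :
  (forall i, cov_rV (LC x i) (a x) (da x i) = 0) -> regular_dom T x y ->
  berwald_connection F i j k x y = LC x j k i.
Proof.
move=> a_par Dy.
have gT := g_sym Ux; have dgT p := dg_sym p Ux; have ug := g_unit Ux.
pose Q : 'M[R]_n := \matrix_(p, q) LC x p q i.
have QE p q : Q p q = LC x p q i by rewrite [LHS]mxE.
have QT : Q^T = Q by apply/matrixP => p q; rewrite mxE !QE levi_civitaC.
have geodesicE z : geodesic_rV (LC x) z 0 i = qf Q z z.
  rewrite /geodesic_rV summxE; apply: eq_bigr => p _; rewrite !mxE mulr_sumr.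
  by apply: eq_bigr => q _; rewrite QE; ring.
have eulerE h z : euler x h z = hcub (g x) (a x) z (e h) (geodesic_rV (LC x) z).
  apply/eqP; rewrite -subr_eq0 (euler_cub_cov (dg x) (da x) (a x) h z gT
    (fun p q r => levi_civitaC (g x) p q r dgT)).
  rewrite (_ : (fun k => cov_mx _ _ _) = fun=> 0); last first.
    by apply/funext => p; exact: cov_levi_civita.
  rewrite (_ : (fun k => cov_rV _ _ _) = fun=> 0); last by apply/funext.
  rewrite /euler_cub /var_cub /var_dcub /cub /dcub.
  apply/eqP; rewrite big1 => [|p _] /=; rewrite !(qf0_mx, lf0_form); ring.
have sprayE z : regular_dom T x z -> spray F i x z = 2^-1 * qf Q z z.
  move=> Dz; rewrite -geodesicE; apply: spray_cub => //;
    [exact: (fun p q => g_diff p q Ux)|exact: (fun p => a_diff p Ux)|].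
  by rewrite mul_hessian_cub //; apply/rowP => h; rewrite !mxE eulerE.
rewrite -QE -qf_delta (qfC _ _ QT) -(partial_diff j (is_diff_qf Q y (e k))).
apply: partial_near; apply: (near_open open_regular Dy) => z Dz.
have D := is_diff_scale 2^-1 (is_diff_quad z QT).
transitivity (partial k (fun z => 2^-1 * qf Q z z) z).
  by apply: partial_near; apply: (near_open open_regular Dz).
by rewrite (partial_diff k D) mulKf ?pnatr_eq0 // qfC.
Qed.

End AtPoint.

End LocalTheorem.

(** * From a single chart to the manifold *)

Theorem theorem9 (R : realType) (n : nat) (M : smooth_manifold R n)
    (gamma : riemannian_metric M) (b : one_form M) :
  unit_form gamma b ->
  (berwald_type
     (fun c x y => regular_dom (cubic gamma b c) x y)
     (fun c x y => cube_root (cubic gamma b c x y))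
   <-> parallel_form gamma b).
Proof.
move=> b_unit.
have nablaE c i j x :
    nabla_form gamma b c i j x = cov_rV (levi_civita (gamma c x)
      (partial_mx (gamma c) x) i) (b c x) (partial_rV (b c) x i) 0 j.
  rewrite /cov_rV [RHS]mxE [X in X + _]mxE [X in _ + X]mxE [in X in _ - X]mxE.
  congr (_ - _); apply: eq_bigr => k _; rewrite mulrC; congr (_ * _).
  rewrite !mxE /christoffel; congr (_ * _); apply: eq_bigr => l _.
  by rewrite !mxE.
split=> [berwald c x ac cx i j|par c ac i j k].
(* With [x] fixed, the functions of [x] given by the Berwald condition become constants, chosen for
   all indices at once. *)
- have Gamma_ex p q r : exists G, forall y, regular_dom (cubic gamma b c) x y ->
      berwald_connection (fun x y => cube_root (cubic gamma b c x y)) p q r x y = G.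
    have [G GE] := berwald c ac p q r.
    by exists (G x) => y; exact: GE.
  pose Gamma p q r := projT1 (cid (Gamma_ex p q r)).
  have GammaE p q r := projT2 (cid (Gamma_ex p q r)).
  rewrite nablaE (@berwald_parallel _ _ _ (gamma c) (b c) (@chart_cod_open _ _ _ c)
    (metric_smooth gamma ac) (form_smooth b ac) (fun x => @Defs.metric_sym _ _ _ gamma c x ac)
    (fun x => @metric_pos _ _ _ gamma c x ac)
    (fun x => b_unit c x ac) x cx Gamma GammaE).
  by rewrite mxE.
(* The witness is the Christoffel symbol $\Gamma^i_{jk}$ of the metric. *)
- exists (fun x => levi_civita (gamma c x) (partial_mx (gamma c) x) j k i) => x y cx Dy.
  apply: (@parallel_berwald _ _ _ (gamma c) (b c) (@chart_cod_open _ _ _ c)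
    (metric_smooth gamma ac) (form_smooth b ac) (fun x => @Defs.metric_sym _ _ _ gamma c x ac)
    (fun x => @metric_pos _ _ _ gamma c x ac)
    x cx i j k y _ Dy).
  by move=> p; apply/rowP => q; rewrite -nablaE par // mxE.
Qed.
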